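(* For any integer $t\geq2$, the average of the $t$-defect $d_t(\lambda)$ over the partitions $\lambda$ of $n$ is asymptotic to $n/(t-1)$; that is, \[ \frac{1}{p(n)}\sum_{\lambda\vdash n}d_t(\lambda)\sim\frac{n}{t-1}\qquad\text{as } n\to\infty, \] where $p(n)$ is the number of partitions of $n$.
   Context: Partitions: $|\lambda|$ is the sum of the parts of a partition $\lambda$, with $|\emptyset|=0$ for the empty partition, and $\lambda\vdash n$ means $|\lambda|=n$. For a finite collection (tuple, counted with multiplicity) $X$ of partitions, $|X|$ is the sum of the sizes of the partitions in $X$. $t$-core and $t$-quotient: for $t\ge2$, a $t$-core is a partition none of whose hook lengths is divisible by $t$. The $t$-core $\lambda_{(t)}$ of $\lambda$ is the $t$-core obtained from $\lambda$ by successively removing (rim) hooks of length divisible by $t$ until none remain (the result is independent of choices). The $t$-quotient $\lambda^{(t)}$ is the standard $t$-tuple of partitions defined by the $t$-abacus: pick $N$ divisible by $t$ with $N$ at least the number of parts of $\lambda=(\lambda_1\ge\lambda_2\ge\dots)$ (padded with zeros), let $X=\{\lambda_i+N-i: 1\le i\le N\}$, and for $0\le r\le t-1$ let $X_r=\{x\ge0: tx+r\in X\}$; writing $X_r=\{x_1>x_2>\dots>x_m\}$, the $r$-th component of $\lambda^{(t)}$ is the partition with parts $x_i-(m-i)$, $1\le i\le m$ (zeros discarded). The map $\lambda\mapsto(\lambda_{(t)},\lambda^{(t)})$ is a bijection from partitions to pairs ($t$-core, $t$-tuple of partitions), and $|\lambda|=|\lambda_{(t)}|+t|\lambda^{(t)}|$.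 Towers: set $\alpha_0(t;\lambda)=(\lambda)$, and for $j\ge1$ let $\alpha_j(t;\lambda)$ be the tuple of $t^j$ partitions obtained by taking, in order, the $t$-quotients of all the partitions in $\alpha_{j-1}(t;\lambda)$. The $j$-th row $\beta_j(t;\lambda)$ of the $t$-core tower of $\lambda$ is the tuple of $t$-cores of the partitions in $\alpha_j(t;\lambda)$. For each $\lambda$, all the partitions in $\alpha_j(t;\lambda)$ are empty for all sufficiently large $j$. Defect: for every integer $t\ge2$ (not necessarily prime), the $t$-defect of $\lambda$ is \[ d_t(\lambda):=\frac{|\lambda|-\sum_{j\geq0}|\beta_j(t;\lambda)|}{t-1}. \] *)

(* Defs.v *)
From HB Require Import structures.
From mathcomp Require Import all_boot all_order all_algebra.
From mathcomp Require Import all_classical all_reals all_analysis.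
Import numFieldNormedType.Exports.

Set Implicit Arguments.
Unset Strict Implicit.
Unset Printing Implicit Defensive.

(** * Partitions *)

(* A partition is the weakly decreasing sequence of its (nonzero) parts. *)
Definition is_partition (la : seq nat) : bool :=
  sorted geq la && (0 \notin la).

Definition row_len (la : seq nat) (i : nat) : nat := nth 0 la i.
Definition col_len (la : seq nat) (j : nat) : nat :=
  count (fun x => j < x) la.

(* A partition of n has at most n parts, each of them at most n, so the
   partitions of n form a finite set of bounded sequences. *)
Definition parts n (s : n.-bseq 'I_n.+1) : seq nat := map val s.

Definition partitions (n : nat) : {set n.-bseq 'I_n.+1} :=
  [set s | is_partition (parts s) && (sumn (parts s) == n)].

Definition npartitions (n : nat) : nat := #|partitions n|.

Lemma parts_inj n : injective (@parts n).
Proof. by move=> s1 s2 /(inj_map val_inj) /val_inj. Qed.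

Lemma partitionsP n la :
  reflect (exists2 s, s \in partitions n & parts s = la)
          (is_partition la && (sumn la == n)).
Proof.
apply: (iffP idP) => [/andP[pla /eqP sla]|[s]]; last first.
  by rewrite inE => + <-.
have size_le : size la <= n.
  case/andP: pla => _; rewrite -sla.
  elim: la {sla} => //= x la IHla; rewrite inE negb_or => /andP[x0 /IHla].
  by rewrite -[(size la).+1]add1n => /(leq_add _)-> //; rewrite lt0n eq_sym.
have val_le x : x \in la -> x < n.+1.
  rewrite ltnS -sla; elim: la {pla sla size_le} => //= y la IHla.
  rewrite inE => /orP[/eqP->|/IHla/leq_trans->//]; first exact: leq_addr.
  exact: leq_addl.
have size_s : size [seq inord x : 'I_n.+1 | x <- la] <= n by rewrite size_map.
have parts_s : parts (Bseq size_s) = la.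
  rewrite /parts /= -map_comp -[RHS]map_id; apply/eq_in_map => x xla /=.
  by rewrite inordK // val_le.
by exists (Bseq size_s) => //; rewrite inE parts_s pla sla eqxx.
Qed.

(** * Hooks and t-cores *)

(* Rows and columns of the Young diagram are numbered from 0. *)
Definition in_diagram (la : seq nat) (i j : nat) : bool := j < row_len la i.

Definition cells (la : seq nat) : seq (nat * nat) :=
  [seq (i, j) | i <- iota 0 (size la), j <- iota 0 (row_len la i)].

(* arm + leg + 1 *)
Definition hook_length (la : seq nat) (i j : nat) : nat :=
  (row_len la i - j.+1) + (col_len la j - i.+1) + 1.

Definition is_t_core (t : nat) (la : seq nat) : bool :=
  all (fun c => ~~ (t %| hook_length la c.1 c.2)) (cells la).

(* The rim hook associated with the cell (i, j) consists of the cells of the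
   rim (those with no cell diagonally below them) lying weakly below and weakly
   to the right of (i, j); it has hook_length la i j cells. *)
Definition in_rim_hook (la : seq nat) (i j k l : nat) : bool :=
  [&& in_diagram la k l, ~~ in_diagram la k.+1 l.+1, i <= k & j <= l].

Definition remove_rim_hook (la : seq nat) (i j : nat) : seq nat :=
  [seq x <- [seq count (fun l => ~~ in_rim_hook la i j k l)
                       (iota 0 (row_len la k)) | k <- iota 0 (size la)]
       | 0 < x].

(* Remove the rim hook of the first cell (in row-major order) whose hook length
   is divisible by t, if there is any. *)
Definition t_core_step (t : nat) (la : seq nat) : seq nat :=
  if [seq c <- cells la | t %| hook_length la c.1 c.2] is (i, j) :: _
  then remove_rim_hook la i j else la.

(* Every effective step removes at least one cell and a t-core is a fixed point
   of t_core_step t, so |la| steps suffice to reach the t-core. *)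
Definition t_core (t : nat) (la : seq nat) : seq nat :=
  iter (sumn la) (t_core_step t) la.

(** * t-quotients *)

(* The set X = {la_i + N - i : 1 <= i <= N} and the sets X_r, listed in
   decreasing order; indices i are shifted by one. *)
Definition beta_set (N : nat) (la : seq nat) : seq nat :=
  [seq row_len la i + N - i.+1 | i <- iota 0 N].

Definition runner (t r : nat) (X : seq nat) : seq nat :=
  [seq x %/ t | x <- X & x %% t == r].

Definition partition_of_beta_set (X : seq nat) : seq nat :=
  [seq x <- [seq nth 0 X i - (size X - i.+1) | i <- iota 0 (size X)] | 0 < x].

(* N = t * (number of parts) is a multiple of t that is at least the number of
   parts. *)
Definition t_quotient (t : nat) (la : seq nat) : seq (seq nat) :=
  [seq partition_of_beta_set (runner t r (beta_set (t * size la) la))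
     | r <- iota 0 t].

(** * Towers and defect *)

Fixpoint quotient_tower_row (t : nat) (la : seq nat) (j : nat) : seq (seq nat) :=
  if j is j'.+1 then flatten (map (t_quotient t) (quotient_tower_row t la j'))
  else [:: la].

Definition core_tower_row (t : nat) (la : seq nat) (j : nat) : seq (seq nat) :=
  map (t_core t) (quotient_tower_row t la j).

Definition total_size (X : seq (seq nat)) : nat := sumn (map sumn X).

Local Open Scope ring_scope.

(* The infinite sum is a limit of partial sums in R; all but finitely many of
   its terms vanish. *)
Definition defect (R : realType) (t : nat) (la : seq nat) : R :=
  ((sumn la)%:R
     - limn (series (fun j => (total_size (core_tower_row t la j))%:R : R)))
  / (t%:R - 1).

Definition average_defect (R : realType) (t n : nat) : R :=
  (npartitions n)%:R^-1 * \sum_(s in partitions n) defect R t (parts s).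

(* Main.v *)
Require Import Defs.
From mathcomp Require Import all_boot all_order all_algebra.
From mathcomp Require Import all_classical all_reals all_analysis.
From mathcomp Require Import zify ring lra.
Import numFieldNormedType.Exports.

(** Write u_j and w_j for the sizes of the j-th rows of the core tower and of
    the quotient tower of a partition la of n, and S for the sum of all u_j.
    The defect is (n - S) / (t - 1), so the theorem says that the average of S
    over the partitions of n is o(n).

    The core and the quotient of a partition satisfy
    |core| + t |quotient| <= |la| ([sumn_t_core_quotient]): on the abacus,
    removing a rim hook of length divisible by t slides a bead down its runner,
    and in the core all runners are pushed down. Hence
    u_j + t w_(j+1) <= w_j, and for every fixed J this yields
    S <= (n - T w_J) + w_J with T = t^J ([core_tower_sum_le]), where
    w_J <= n / T. Fixing J large, it remains to see that T w_J is close to n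
    for most partitions.

    A partition is determined by the numbers of beads on the runners of all the
    partitions in rows 0, ..., J - 1, together with row J
    ([tower_charges_inj]). The former take only polynomially many values in n.
    The latter is a T-tuple of partitions, and T-tuples of total size w inject
    into partitions of size at most T w: replace each part x of the r-th
    component by T x - r ([merge_residues]). So the number of la with
    T w_J <= (1 - 1/E) n is at most a polynomial in n times p((1 - 1/E) n)
    ([count_light_tower]).

    This is negligible against p(n) ([light_tower_rare]), because
    d^2 p(m) <= 2 (m + d) p(m + d) ([npartitions_step]): iterated r times with
    steps d proportional to n, it shows that p(n) exceeds p((1 - 1/E) n) by a
    factor of order n^r, for every r.
*)

Set Implicit Arguments.
Unset Strict Implicit.
Unset Printing Implicit Defensive.

Arguments row_len : simpl never.

(** * Partitions and their row lengths *)

Lemma is_partition_cons x la :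
  is_partition (x :: la) = [&& 0 < x, nth 0 la 0 <= x & is_partition la].
Proof.
rewrite /is_partition inE negb_or eq_sym -lt0n /=.
by rewrite andbCA; case: la => [|y la] /=; rewrite ?nth_nil ?leq0n // !andbA.
Qed.

Lemma sorted_geq_nth s i j : sorted geq s -> i <= j -> nth 0 s j <= nth 0 s i.
Proof.
move=> ss ij; have [js|sj] := ltnP j (size s); last by rewrite nth_default.
apply: (sorted_leq_nth _ _ _ ss); rewrite ?inE //; first by move=> ? ? ? /= h /leq_trans; apply.
- by move=> x /=.
- exact: leq_ltn_trans js.
Qed.

Lemma row_len_mono la i j : is_partition la -> i <= j -> row_len la j <= row_len la i.
Proof. by case/andP=> ss _; exact: sorted_geq_nth. Qed.

(** The zeros of a weakly decreasing sequence are at its end, where the default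
    value of nth stands in for them. *)
Lemma nth_filter_gt0 s i :
  sorted geq s -> nth 0 [seq x <- s | 0 < x] i = nth 0 s i.
Proof.
elim: s i => [|x s IHs] i //= pxs; have ss := path_sorted pxs.
case: posnP => [x0|x_gt0]; last by case: i => //= i; apply: IHs.
have sx k : nth 0 s k = 0.
  by apply/eqP; rewrite -leqn0; have /= := @sorted_geq_nth (x :: s) 0 k.+1 pxs isT; rewrite x0.
by rewrite IHs // sx; case: i => //= i; rewrite sx.
Qed.

Lemma is_partition_filter s : sorted geq s -> is_partition [seq x <- s | 0 < x].
Proof.
move=> ss; rewrite /is_partition mem_filter ltnn /= andbT.
by apply: sorted_filter => // ? ? ? /= h /leq_trans; apply.
Qed.

Lemma row_len_inj la mu : is_partition la -> is_partition mu ->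
  row_len la =1 row_len mu -> la = mu.
Proof.
elim: la mu => [|x la IHla] [|y mu] //.
- by move=> _; rewrite is_partition_cons => /and3P[y0 _ _] /(_ 0); rewrite /row_len /=; lia.
- by rewrite is_partition_cons => /and3P[y0 _ _] _ /(_ 0); rewrite /row_len /=; lia.
rewrite !is_partition_cons => /and3P[_ _ pla] /and3P[_ _ pmu] E.
by rewrite (E 0 : x = y) (IHla mu) // => i; apply: (E i.+1).
Qed.

Lemma sorted_mkseq (e : rel nat) (f : nat -> nat) n :
  (forall i, i.+1 < n -> e (f i) (f i.+1)) -> sorted e [seq f i | i <- iota 0 n].
Proof.
move=> ef; apply/(sortedP 0) => i; rewrite size_map size_iota => lt_in.
by have := ltnW lt_in; move=> lt_in'; rewrite !(nth_map 0) ?size_iota ?nth_iota //; apply: ef.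
Qed.

Lemma sumn_row_len N la : size la <= N -> sumn la = \sum_(0 <= i < N) row_len la i.
Proof.
move=> le_N; rewrite (@big_cat_nat _ _ _ (size la)) //= sumnE (big_nth 0) [X in _ + X]big_nat_cond.
by rewrite [X in _ + X]big1 ?addn0 // => i /andP[/andP[si _] _]; apply: nth_default.
Qed.

Lemma leq_size_sumn la : is_partition la -> size la <= sumn la.
Proof.
elim: la => //= x la IHla; rewrite is_partition_cons => /and3P[x0 _ /IHla]; lia.
Qed.

(** * Beta sets *)

(** Position of the bead of row i on an abacus with N beads; rows past the last
    part contribute the beads at the bottom. *)
Definition bead la N i := row_len la i + N - i.+1.

Lemma size_beta_set N la : size (beta_set N la) = N.
Proof. by rewrite size_map size_iota. Qed.

Lemma nth_beta_set N la i : i < N -> nth 0 (beta_set N la) i = bead la N i.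
Proof. by move=> iN; rewrite (nth_map 0) ?size_iota // nth_iota. Qed.

Lemma beta_set_sorted N la : is_partition la -> sorted gtn (beta_set N la).
Proof.
move=> pla; apply: sorted_mkseq => i iN /=.
have := row_len_mono pla (leqnSn i); lia.
Qed.

(** Consecutive beads are at distance at least one. *)
Lemma sorted_gtn_gap X i j : sorted gtn X -> i <= j -> j < size X ->
  nth 0 X j + (j - i) <= nth 0 X i.
Proof.
move=> /(sortedP 0) sX; elim: j => [|j IHj]; first by rewrite leqn0 => /eqP->; lia.
rewrite leq_eqVlt => /orP[/eqP<-|ij jX]; first by rewrite subnn addn0.
have := IHj ij (ltnW jX); have := sX _ jX => /=; lia.
Qed.

Lemma sorted_gtn_nth X i : sorted gtn X -> size X - i.+1 <= nth 0 X i.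
Proof.
move=> sX; have [iX|] := ltnP i (size X); last by move=> ?; lia.
have jX : (size X).-1 < size X by lia.
have := @sorted_gtn_gap X i (size X).-1 sX; lia.
Qed.

Lemma sorted_gtn_uniq X : sorted gtn X -> uniq X.
Proof. by apply: sorted_uniq => [x y z /= h1 h2|x /=]; [exact: ltn_trans h2 h1|rewrite ltnn]. Qed.

Lemma pre_partition_sorted X : sorted gtn X ->
  sorted geq [seq nth 0 X i - (size X - i.+1) | i <- iota 0 (size X)].
Proof.
move=> /(sortedP 0) sX; apply: sorted_mkseq => i iX /=; have := sX _ iX => /=; lia.
Qed.

Lemma is_partition_of_beta_set X : sorted gtn X -> is_partition (partition_of_beta_set X).
Proof. by move=> sX; apply/is_partition_filter/pre_partition_sorted. Qed.

Lemma row_len_of_beta_set X i : sorted gtn X ->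
  row_len (partition_of_beta_set X) i = nth 0 X i - (size X - i.+1).
Proof.
move=> sX; rewrite /row_len nth_filter_gt0 ?pre_partition_sorted //.
have [iX|Xi] := ltnP i (size X); last by rewrite !nth_default ?size_map ?size_iota.
by rewrite (nth_map 0) ?size_iota // nth_iota.
Qed.

Lemma size_of_beta_set X : size (partition_of_beta_set X) <= size X.
Proof. by rewrite size_filter (leq_trans (count_size _ _)) // size_map size_iota. Qed.

Lemma partition_of_beta_setK X : sorted gtn X ->
  beta_set (size X) (partition_of_beta_set X) = X.
Proof.
move=> sX; apply: (@eq_from_nth _ 0); rewrite size_beta_set // => i iX.
rewrite nth_beta_set // /bead row_len_of_beta_set //.
have := sorted_gtn_nth i sX; lia.
Qed.

Lemma beta_setK N la : is_partition la -> size la <= N ->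
  partition_of_beta_set (beta_set N la) = la.
Proof.
move=> pla sla; have sX := beta_set_sorted N pla.
apply: row_len_inj => //; first exact: is_partition_of_beta_set.
move=> i; rewrite row_len_of_beta_set // size_beta_set.
have [iN|Ni] := ltnP i N; first by rewrite nth_beta_set // /bead; lia.
by rewrite nth_default ?size_beta_set // /row_len nth_default // (leq_trans sla).
Qed.

(** The empty partition has beads 0, ..., N - 1, and adding a cell moves one
    bead by one step. *)
Lemma sumn_beta_set N la : size la <= N -> sumn (beta_set N la) = sumn la + 'C(N, 2).
Proof.
move=> sla; rewrite (sumn_row_len sla) -bin2_sum sumnE big_map.
have -> : iota 0 N = index_iota 0 N by rewrite /index_iota subn0.
rewrite [X in _ = _ + X]big_nat_rev /= -big_split /=.
by apply: eq_big_nat => i /andP[_ iN]; rewrite add0n; lia.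
Qed.

Lemma sumn_of_beta_set X : sorted gtn X ->
  sumn X = sumn (partition_of_beta_set X) + 'C(size X, 2).
Proof.
by move=> sX; rewrite -sumn_beta_set ?size_of_beta_set // partition_of_beta_setK.
Qed.

(** * Runners of the abacus *)

Lemma runner_sorted t r X : sorted gtn X -> sorted gtn (runner t r X).
Proof.
move=> sX; apply: (@homo_sorted_in _ _ [pred x | x %% t == r] (fun x => x %/ t) gtn gtn).
- move=> x y /eqP xr /eqP yr /=; rewrite {1}(divn_eq x t) {1}(divn_eq y t) xr yr.
  by rewrite ltn_add2r ltn_mul2r => /andP[].
- exact: filter_all.
- by apply: sorted_filter => // ? ? ? /= h1 h2; exact: ltn_trans h2 h1.
Qed.

Lemma size_runner t r X : size (runner t r X) = count (fun x => x %% t == r) X.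
Proof. by rewrite size_map size_filter. Qed.

Lemma mem_runner t r q X : r < t -> (q \in runner t r X) = (q * t + r \in X).
Proof.
move=> rt; apply/mapP/idP => [[x]|qX].
  by rewrite mem_filter => /andP[/eqP <- xX] ->; rewrite -divn_eq.
exists (q * t + r); last by rewrite divnMDl ?divn_small ?addn0 //; lia.
by rewrite mem_filter qX andbT modnMDl modn_small.
Qed.

(** Each bead x is t * (x %/ t) + x %% t, and lies on the runner x %% t. *)
Lemma sumn_runner t X : 0 < t ->
  sumn X = \sum_(r < t) (t * sumn (runner t r X) + r * size (runner t r X)).
Proof.
move=> t0; elim: X => [|x X IHX] /=.
  by rewrite big1 // => r _; rewrite !muln0.
rewrite IHX; have rt : x %% t < t by rewrite ltn_mod.
rewrite (bigD1 (Ordinal rt)) //= [RHS](bigD1 (Ordinal rt)) //=.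
rewrite /runner /= eqxx /= addnA; congr (_ + _); last first.
  by apply: eq_bigr => r; rewrite -val_eqE /= eq_sym => /negPf->.
rewrite {1}(divn_eq x t); lia.
Qed.

Lemma sumn_t_quotient t la :
  total_size (t_quotient t la) =
    \sum_(r < t) sumn (partition_of_beta_set (runner t r (beta_set (t * size la) la))).
Proof.
rewrite /total_size /t_quotient -map_comp sumnE big_map -(subn0 t).
by rewrite -/(index_iota 0 t) big_mkord subn0.
Qed.

Lemma size_t_quotient t la : size (t_quotient t la) = t.
Proof. by rewrite size_map size_iota. Qed.

Lemma is_partition_t_quotient t la : is_partition la -> all is_partition (t_quotient t la).
Proof.
move=> pla; apply/allP => mu /mapP[r _ ->].
exact/is_partition_of_beta_set/runner_sorted/beta_set_sorted.
Qed.

(** * Rim hook removal as a bead move *)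

(** Rows are weakly decreasing, so the rows reaching column j are the first
    ones. *)
Lemma ltn_col_len la j k : is_partition la -> (k < col_len la j) = (j < row_len la k).
Proof.
rewrite /col_len /row_len; elim: la k => [|x la IHla] k /=; first by rewrite nth_nil.
rewrite is_partition_cons => /and3P[_ hx pla].
case: k => [|k] /=; last first.
  case: (ltnP j x) => [_|xj]; first by rewrite add1n ltnS IHla.
  have n0 m : (m < count [eta leq j.+1] la) = false.
    rewrite IHla //; apply/negbTE; rewrite -leqNgt.
    by apply: leq_trans (leq_trans hx xj); exact: (@row_len_mono la 0 m).
  by rewrite add0n n0 -IHla // n0.
case: (ltnP j x) => // xj; rewrite add0n IHla //; apply/negbTE; rewrite -leqNgt.
exact: leq_trans xj.
Qed.

Lemma count_lt_iota c a : count (fun l => l < c) (iota 0 a) = minn c a.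
Proof.
elim: a => [|a IHa]; first by rewrite minn0.
by rewrite -addn1 iotaD count_cat IHa /=; lia.
Qed.

Definition kept_cells la i j k :=
  count (fun l => ~~ in_rim_hook la i j k l) (iota 0 (row_len la k)).

(** In a row k >= i the rim hook takes the cells from column max(j, la_(k+1) -
    1) on; the minimum covers the rows that end before column j. *)
Lemma kept_cellsE la i j k : kept_cells la i j k =
  if i <= k then minn (maxn j (row_len la k.+1).-1) (row_len la k)
  else row_len la k.
Proof.
rewrite /kept_cells; case: ifP => ik; last first.
  rewrite -[RHS](size_iota 0) -[RHS]count_predT; apply: eq_in_count => l _.
  by rewrite /in_rim_hook ik /= !andbF.
rewrite -count_lt_iota; apply: eq_in_count => l.
rewrite mem_iota add0n /= => la_l; rewrite /in_rim_hook /in_diagram ik la_l /=; lia.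
Qed.

Lemma kept_cells_sorted la i j : is_partition la ->
  sorted geq [seq kept_cells la i j k | k <- iota 0 (size la)].
Proof.
move=> pla; apply: sorted_mkseq => k _ /=; rewrite !kept_cellsE.
have := row_len_mono pla (leqnSn k); have := row_len_mono pla (leqnSn k.+1).
by case: ifP; case: ifP; lia.
Qed.

Lemma is_partition_remove_rim_hook la i j : is_partition la ->
  is_partition (remove_rim_hook la i j).
Proof. by move=> pla; apply/is_partition_filter/kept_cells_sorted. Qed.

Lemma size_remove_rim_hook la i j : size (remove_rim_hook la i j) <= size la.
Proof. by rewrite size_filter (leq_trans (count_size _ _)) // size_map size_iota. Qed.

(** Each row of the hook but the last becomes one cell shorter than the row
    below it was, and the last one is cut at column j. *)
Lemma row_len_remove_rim_hook la i j k : is_partition la ->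
  row_len (remove_rim_hook la i j) k =
    if (i <= k) && (j < row_len la k) then maxn j (row_len la k.+1).-1
    else row_len la k.
Proof.
move=> pla; rewrite {1}/row_len /remove_rim_hook nth_filter_gt0; last exact: kept_cells_sorted.
have [ks|sk] := ltnP k (size la); last first.
  by rewrite /row_len !nth_default ?size_map ?size_iota //; [rewrite ltn0 andbF | lia].
rewrite (nth_map 0) ?size_iota // nth_iota // add0n -/(kept_cells la i j k) kept_cellsE.
have := row_len_mono pla (leqnSn k); case: (i <= k) => //=; case: ifP; lia.
Qed.

(** Removing a rim hook of length h moves one bead down by h. By the row
    lengths after removal, the beads of the rows below i that meet the hook
    move up one row, and the freed place is taken by the bead of column j,
    which sits at j plus the number of beads below the hook. As a multiset, the
    bead of row i is replaced by this new one. *)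
Lemma beta_set_remove_rim_hook N la i j :
  is_partition la -> size la <= N -> in_diagram la i j ->
  forall y, y = j + N - col_len la j ->
  bead la N i = hook_length la i j + y /\
  perm_eq (bead la N i :: beta_set N (remove_rim_hook la i j)) (y :: beta_set N la).
Proof.
rewrite /in_diagram => pla sla ij y; set c := col_len la j => yE.
have ic : i < c by rewrite ltn_col_len.
have cN : c <= N by rewrite (leq_trans (count_size _ _)).
split; first by rewrite /bead /hook_length -/c yE; lia.
(* The rows of the hook are i, ..., c - 1. *)
have iotaN : iota 0 N = iota 0 i ++ i :: iota i.+1 (c - i.+1) ++ iota c (N - c).
  have -> : N = i + (1 + ((c - i.+1) + (N - c))) by lia.
  rewrite !iotaD /= !add0n addn1 (_ : i.+1 + (c - i.+1) = c); last by lia.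
  congr (_ ++ _ :: _ ++ iota _ _); lia.
have iotaN' : iota 0 N = iota 0 i ++ iota i (c - i.+1) ++ c.-1 :: iota c (N - c).
  have -> : N = i + ((c - i.+1) + (1 + (N - c))) by lia.
  rewrite !iotaD /= !add0n (_ : i + (c - i.+1) = c.-1); last by lia.
  rewrite addn1 prednK; last by lia.
  congr (_ ++ _ ++ _ :: iota _ _); lia.
rewrite {1}/beta_set iotaN' /beta_set iotaN !map_cat /= !map_cat.
set x' := fun k => row_len (remove_rim_hook la i j) k + N - k.+1.
have x'E k : k < N -> x' k = if (k < i) || (c <= k) then bead la N k
    else if k.+1 == c then y else bead la N k.+1.
  move=> kN; rewrite /x' row_len_remove_rim_hook // /bead yE.
  have := ltn_col_len j k pla; have := ltn_col_len j k.+1 pla; rewrite -/c.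
  by case: ifP => ?; (case: ifP => ?; last case: ifP => ?); lia.
have -> : [seq x' k | k <- iota 0 i] = [seq bead la N k | k <- iota 0 i].
  by apply/eq_in_map => k; rewrite mem_iota add0n /= => ki; rewrite x'E ?ki //; lia.
have -> : [seq x' k | k <- iota c (N - c)] = [seq bead la N k | k <- iota c (N - c)].
  by apply/eq_in_map => k; rewrite mem_iota => kc; rewrite x'E; [rewrite ifT // | ]; lia.
have -> : [seq x' k | k <- iota i (c - i.+1)] =
    [seq bead la N k | k <- iota i.+1 (c - i.+1)].
  rewrite -add1n iotaDl -map_comp; apply/eq_in_map => k; rewrite mem_iota => kc /=.
  rewrite x'E; last by lia.
  by rewrite ifN ?ifN //; lia.
have -> : row_len (remove_rim_hook la i j) c.-1 + N - c.-1.+1 = y.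
  rewrite -/(x' _) x'E; last by lia.
  by rewrite ifN ?ifT //; lia.
apply/permP => a; rewrite /bead /= !count_cat /= !count_cat /=; lia.
Qed.

Lemma hook_length_gt0 la i j : 0 < hook_length la i j.
Proof. by rewrite /hook_length addn1. Qed.

Lemma mem_cells la i j : is_partition la -> ((i, j) \in cells la) = in_diagram la i j.
Proof.
move=> pla; apply/allpairsPdep/idP => [[a [b [_]]]|ij].
  by rewrite mem_iota /= => bl [-> ->].
exists i, j; split=> //; rewrite mem_iota // add0n /=.
by rewrite ltnNge; apply: contraL ij => si; rewrite /in_diagram /row_len nth_default.
Qed.

Lemma t_core_stepP t la : is_partition la ->
  is_t_core t la /\ t_core_step t la = la \/
  exists i j, [/\ in_diagram la i j, t %| hook_length la i j &
    t_core_step t la = remove_rim_hook la i j].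
Proof.
move=> pla; rewrite /t_core_step.
case E: [seq c <- cells la | t %| hook_length la c.1 c.2] => [|[i j] s].
  left; split=> //; apply/allP => c cla; apply/negP => tc.
  by have := mem_filter (fun c => t %| hook_length la c.1 c.2) c (cells la); rewrite E tc cla.
right; exists i, j; have : (i, j) \in (i, j) :: s by rewrite inE eqxx.
by rewrite -E mem_filter mem_cells // => /andP[].
Qed.

Lemma sumn_remove_rim_hook la i j : is_partition la -> in_diagram la i j ->
  sumn (remove_rim_hook la i j) + hook_length la i j = sumn la.
Proof.
move=> pla ij; have [hE pE] := beta_set_remove_rim_hook pla (leqnn _) ij erefl.
have sla' := @size_remove_rim_hook la i j.
move/perm_sumn: pE => /=; rewrite !sumn_beta_set //; lia.
Qed.

(** A bead moved by a multiple of t stays on its runner, so the number of beads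
    on each runner is an invariant of the reduction to the core. The number N
    of beads has to be kept fixed for this, although the number of parts may
    drop. *)
Lemma iter_t_core_step t N la n : is_partition la -> size la <= N ->
  let la' := iter n (t_core_step t) la in
  [/\ is_partition la', size la' <= N &
   forall r, size (runner t r (beta_set N la')) = size (runner t r (beta_set N la))].
Proof.
move=> pla sla /=; elim: n => [|n [/= pn sn en]] //=.
set mu := iter _ _ _ in pn sn en *.
have [[_ ->] //|[i [j [ij tij ->]]]] := t_core_stepP t pn.
split; first exact: is_partition_remove_rim_hook.
  exact: leq_trans (@size_remove_rim_hook _ _ _) sn.
move=> r; rewrite -en !size_runner.
have [hE /permP/(_ (fun x => x %% t == r)) /=] := beta_set_remove_rim_hook pn sn ij erefl.
have [k kE] := dvdnP tij; rewrite hE kE modnMDl; lia.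
Qed.

(** Each removal lowers the size by at least one. *)
Lemma iter_t_core_step_core t la n : is_partition la -> sumn la <= n ->
  is_t_core t (iter n (t_core_step t) la).
Proof.
elim: n la => [|n IHn] la pla.
  rewrite leqn0 => /eqP la0; have := leq_size_sumn pla.
  by rewrite la0 leqn0 => /nilP ->.
rewrite iterSr => nla; have [[ct ->]|[i [j [ij tij ->]]]] := t_core_stepP t pla.
  have: t_core_step t la = la.
    have [[]//|[i [j [ij tij _]]]] := t_core_stepP t pla.
    by move/allP: ct => /(_ (i, j)); rewrite mem_cells // ij tij => /(_ isT).
  by move=> st; rewrite (_ : iter n _ la = la) //; elim: n {IHn nla} => //= n ->.
apply: IHn; first exact: is_partition_remove_rim_hook.
have := sumn_remove_rim_hook pla ij; have := hook_length_gt0 la i j; lia.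
Qed.

(** * Sizes of the core and of the quotient *)

(** Conversely to the bead move: a bead at row i and a free position y below it
    come from a cell of row i, of hook length their distance. *)
Lemma hook_of_gap N la i y : is_partition la -> size la <= N -> i < N ->
  y < bead la N i -> y \notin beta_set N la ->
  exists2 j, in_diagram la i j & hook_length la i j = bead la N i - y.
Proof.
move=> pla sla iN yi yX; set X := beta_set N la.
have sX : sorted gtn X := beta_set_sorted N pla.
have Xlt k : k.+1 < N -> bead la N k.+1 < bead la N k.
  by move=> kN; rewrite -!nth_beta_set //; [apply: (sortedP 0 sX); rewrite size_beta_set | lia].
have Xy k : k < N -> bead la N k != y.
  move=> kN; apply: contraNneq yX => <-.
  by rewrite -nth_beta_set // mem_nth // size_beta_set.
(* c counts the beads beyond y; the N - c others lie below y, so the cell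
   sought is in column y - (N - c). *)
have [c [ic cN cy yc]] : exists c, [/\ i < c, c <= N,
    y + (N - c) < bead la N c.-1 + (N - c) & c < N -> bead la N c < y].
  have ex : exists k, (i < k) && ((N <= k) || (bead la N k < y)).
    by exists N; rewrite iN leqnn.
  case: (ex_minnP ex) => c /andP[ic cy] cmin; exists c.
  have cN : c <= N by apply: cmin; rewrite iN leqnn.
  split=> //; last by move=> cN'; move: cy; rewrite leqNgt cN'.
  rewrite ltn_add2r; case: (ltngtP i c.-1) => [ic'|ic'|<- //]; last by lia.
  have := cmin c.-1; have := Xy c.-1; rewrite ic' /=; lia.
have gap : forall a b, a <= b -> b < N -> bead la N b + (b - a) <= bead la N a.
  move=> a b ab bN; rewrite -!nth_beta_set //; last by lia.
  by apply: sorted_gtn_gap => //; rewrite size_beta_set.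
have cN' : N - c <= y.
  case: (ltnP c N) => [cltN|]; last by lia.
  have := gap c N.-1; have := yc cltN; lia.
have jc k : (k < c) = (y - (N - c) < row_len la k).
  have [kN|Nk] := ltnP k N; last first.
    by rewrite /row_len nth_default; lia.
  have := gap k c.-1; have := gap c k; move: cy yc; rewrite /bead; lia.
have ccol : col_len la (y - (N - c)) = c.
  apply/eqP; rewrite eqn_leq; apply/andP; split.
    by rewrite leqNgt ltn_col_len // -jc ltnn.
  case: c jc {ic cN cy yc cN'} => // c jc.
  by rewrite ltn_col_len // -jc.
exists (y - (N - c)); first by rewrite /in_diagram -jc.
have := jc i; rewrite ic /hook_length ccol /bead; lia.
Qed.

(** A bead with a free position t below it would give a hook of length t. *)
Lemma t_core_flush t N la r q : is_partition la -> size la <= N -> is_t_core t la ->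
  r < t -> q.+1 \in runner t r (beta_set N la) -> q \in runner t r (beta_set N la).
Proof.
move=> pla sla ct rt; rewrite !mem_runner // => qX; apply: contraT => q'X.
have [i] := nthP 0 qX; rewrite size_beta_set => iN; rewrite nth_beta_set // => xi.
have lt_y : q * t + r < bead la N i by rewrite xi mulSn; lia.
have [j ij hE] := hook_of_gap pla sla iN lt_y q'X.
have := allP ct (i, j); rewrite mem_cells // ij => /(_ isT) /=.
by rewrite hE xi (_ : _ - _ = t) ?dvdnn // mulSn; lia.
Qed.

Lemma sumn_flush Y : sorted gtn Y ->
  (forall q, q.+1 \in Y -> q \in Y) -> sumn Y = 'C(size Y, 2).
Proof.
move=> sY fY; have uY := sorted_gtn_uniq sY.
have down q k : q \in Y -> k <= q -> k \in Y.
  elim: q => [|q IHq]; first by rewrite leqn0 => ? /eqP->.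
  by move=> qY; rewrite leq_eqVlt => /orP[/eqP->//|]; apply/IHq/fY.
have YS : {subset Y <= iota 0 (size Y)}.
  move=> q qY; rewrite mem_iota add0n /=.
  rewrite -[q.+1](size_iota 0); apply: uniq_leq_size; first exact: iota_uniq.
  by move=> k; rewrite mem_iota add0n ltnS /= => /(down _ _ qY).
have [|_ YE] := uniq_min_size uY YS; first by rewrite size_iota.
rewrite (perm_sumn (uniq_perm uY (iota_uniq 0 (size Y)) YE)).
by rewrite -bin2_sum sumnE /index_iota subn0.
Qed.

(** Let c_r be the number of beads on runner r. The bead sum of la is the sum
    over r of t * (sum of runner r) + r * c_r, and the r-th component of the
    quotient has size (sum of runner r) - C(c_r, 2). The core has the same c_r,
    with runners pushed down to 0, ..., c_r - 1, hence of sum C(c_r, 2). The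
    difference of the two bead sums is t times the size of the quotient. *)
Lemma sumn_t_core_quotient t la : 0 < t -> is_partition la ->
  sumn (t_core t la) + t * total_size (t_quotient t la) <= sumn la.
Proof.
move=> t0 pla; set N := t * size la; have sla : size la <= N by rewrite leq_pmull.
have [pc sc ec] := iter_t_core_step t (sumn la) pla sla; rewrite -/(t_core t la) in pc sc ec.
have ct : is_t_core t (t_core t la) by apply: iter_t_core_step_core.
rewrite -(leq_add2r 'C(N, 2)) -(sumn_beta_set sla) addnAC -sumn_beta_set //.
rewrite sumn_t_quotient -/N !(sumn_runner _ t0) big_distrr /= -big_split /=.
apply: leq_sum => r _; rewrite ec (sumn_of_beta_set (runner_sorted t r (beta_set_sorted N pla))).
rewrite sumn_flush ?ec; last 2 first.
- exact/runner_sorted/beta_set_sorted.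
- by move=> q; apply: t_core_flush.
lia.
Qed.

(** * Recovering a partition from its charges and its quotient *)

(** The numbers of beads on the runners. They stand for the core: each is at
    most the number of beads, so that polynomial bounds on how many values they
    take are immediate. *)
Definition charges t la := [seq size (runner t r (beta_set (t * size la) la)) | r <- iota 0 t].

Lemma size_charges t la : size (charges t la) = t.
Proof. by rewrite size_map size_iota. Qed.

Lemma charges_le t la : all (fun c => c <= t * size la) (charges t la).
Proof.
apply/allP => c /mapP[r _ ->]; rewrite size_runner (leq_trans (count_size _ _)) //.
by rewrite size_beta_set.
Qed.

(** A runner is the beta set of its component with as many beads as its charge;
    the runners together are the beta set of the partition. *)
Lemma charges_quotient_inj t la mu : 0 < t -> is_partition la -> is_partition mu ->
  charges t la = charges t mu -> t_quotient t la = t_quotient t mu -> la = mu.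
Proof.
move=> t0 pla pmu cE qE.
set X := beta_set (t * size la) la; set Y := beta_set (t * size mu) mu.
have sX : sorted gtn X by exact: beta_set_sorted.
have sY : sorted gtn Y by exact: beta_set_sorted.
have rE r : r < t -> runner t r X = runner t r Y.
  move=> rt; rewrite -[LHS]partition_of_beta_setK ?runner_sorted //.
  rewrite -[RHS]partition_of_beta_setK ?runner_sorted //; congr beta_set.
    move/(congr1 (fun s => nth 0 s r)): cE.
    by rewrite !(nth_map 0) ?size_iota // !nth_iota.
  move/(congr1 (fun s => nth [::] s r)): qE.
  by rewrite !(nth_map 0) ?size_iota // !nth_iota.
have XY : X = Y.
  apply: (sorted_eq (leT := gtn)) => //.
  - by move=> ? ? ? /= h1 h2; exact: ltn_trans h2 h1.
  - by move=> x y /= /andP[]; lia.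
  apply: uniq_perm; rewrite ?sorted_gtn_uniq // => x.
  have rt : x %% t < t by rewrite ltn_mod.
  by rewrite (divn_eq x t) -!mem_runner // rE.
by rewrite -(beta_setK pla (leq_pmull _ t0)) -/X XY beta_setK // leq_pmull.
Qed.

(** * Sizes along the towers *)

Lemma total_size_cat X Y : total_size (X ++ Y) = total_size X + total_size Y.
Proof. by rewrite /total_size map_cat sumn_cat. Qed.

Lemma leq_total_size mu X : mu \in X -> sumn mu <= total_size X.
Proof.
elim: X => //= nu X IHX; rewrite inE /total_size /= => /orP[/eqP->|/IHX]; first exact: leq_addr.
by move/leq_trans; apply; exact: leq_addl.
Qed.

Lemma is_partition_tower_row t la j : is_partition la ->
  all is_partition (quotient_tower_row t la j).
Proof.
move=> pla; elim: j => [|j IHj] /=; first by rewrite pla.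
apply/allP => nu /flattenP[Q /mapP[mu muX ->]].
exact/allP/is_partition_t_quotient/(allP IHj).
Qed.

Lemma size_tower_row t la j : size (quotient_tower_row t la j) = t ^ j.
Proof.
elim: j => //= j IHj; rewrite size_flatten /shape -map_comp.
rewrite (eq_map (size_t_quotient t)) expnSr -IHj.
by elim: (quotient_tower_row _ _ _) => //= mu X ->; rewrite mulSn.
Qed.

(** This telescopes along the tower: with u_j and w_j the sizes of the j-th
    rows of the core tower and the quotient tower, u_j + t * w_(j+1) <= w_j. *)
Lemma core_quotient_row_le t X : 0 < t -> all is_partition X ->
  total_size (map (t_core t) X) + t * total_size (flatten (map (t_quotient t) X))
    <= total_size X.
Proof.
move=> t0; elim: X => [|mu X IHX] /=; first by rewrite muln0.
case/andP=> pmu /IHX; have := sumn_t_core_quotient t0 pmu.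
by rewrite total_size_cat mulnDr /total_size /=; lia.
Qed.

Section TowerSums.
Variables (t : nat) (la : seq nat).
Hypotheses (t_gt0 : 0 < t) (pla : is_partition la).
Let u j := total_size (core_tower_row t la j).
Let w j := total_size (quotient_tower_row t la j).

Lemma core_tower_row_le j : u j + t * w j.+1 <= w j.
Proof. exact/core_quotient_row_le/is_partition_tower_row. Qed.

(** Up to row J the inequalities u_j + t * w_(j+1) <= w_j are weighted by t^j,
    which gives u_0 + ... + u_(J-1) <= |la| - t^J w_J; beyond row J they are
    used unweighted, and all later rows together cost at most w_J. *)
Lemma core_tower_sum_le J K :
  \sum_(0 <= j < J + K) u j + t ^ J * w J + w (J + K) <= sumn la + w J.
Proof.
elim: K => [|K IHK]; last first.
  rewrite addnS big_nat_recr //=; have := core_tower_row_le (J + K).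
  have := leq_pmull (w (J + K).+1) t_gt0; lia.
rewrite addn0 leq_add2r; elim: J => [|J IHJ].
  by rewrite big_geq // /w /total_size /= expn0 addn0 mul1n.
rewrite big_nat_recr //= expnS.
have h := core_tower_row_le J; have tJ : 0 < t ^ J by rewrite expn_gt0 t_gt0.
have : t ^ J * (u J + t * w J.+1) <= t ^ J * w J by rewrite leq_mul2l h orbT.
have := leq_pmull (u J) tJ; nia.
Qed.

Lemma tower_row_le J : t ^ J * w J <= sumn la.
Proof. have := core_tower_sum_le J 0; rewrite addn0; lia. Qed.

End TowerSums.

(** * Encoding a partition by charges and one row of its quotient tower *)

Fixpoint tower_charges t la J :=
  if J is j.+1 then tower_charges t la j ++ flatten (map (charges t) (quotient_tower_row t la j))
  else [::].

Lemma size_tower_charges t la J : size (tower_charges t la J) = \sum_(j < J) t ^ j.+1.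
Proof.
elim: J => [|J IHJ]; first by rewrite big_ord0.
rewrite /= size_cat IHJ big_ord_recr /=; congr (_ + _).
rewrite size_flatten /shape -map_comp (eq_map (size_charges t)) expnSr -(size_tower_row t la).
by elim: (quotient_tower_row _ _ _) => //= mu X ->; rewrite mulSn.
Qed.

Lemma tower_charges_le t la J : 0 < t -> is_partition la ->
  all (fun c => c <= t * sumn la) (tower_charges t la J).
Proof.
move=> t0 pla; elim: J => //= J IHJ; rewrite all_cat IHJ /=.
apply/allP => c /flattenP[s /mapP[mu muX ->]] /(allP (charges_le t mu)) /leq_trans; apply.
rewrite leq_mul2l; apply/orP; right.
have /leq_size_sumn/leq_trans-> // := allP (is_partition_tower_row t J pla) mu muX.
rewrite (leq_trans (leq_total_size muX)) // (leq_trans _ (tower_row_le t0 pla J)) //.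
by rewrite leq_pmull // expn_gt0 t0.
Qed.

(** Charge lists and quotients have the same length t for every partition, so
    the concatenations can be cut apart again. *)
Lemma charges_quotients_inj t X Y : 0 < t -> all is_partition X -> all is_partition Y ->
  size X = size Y -> flatten (map (charges t) X) = flatten (map (charges t) Y) ->
  flatten (map (t_quotient t) X) = flatten (map (t_quotient t) Y) -> X = Y.
Proof.
move=> t0; elim: X Y => [|mu X IHX] [|nu Y] //= /andP[pmu pX] /andP[pnu pY] [sXY].
move=> /eqP; rewrite eqseq_cat ?size_charges // => /andP[/eqP c1 /eqP c2].
move=> /eqP; rewrite eqseq_cat ?size_t_quotient // => /andP[/eqP q1 /eqP q2].
by rewrite (charges_quotient_inj t0 pmu pnu c1 q1) (IHX Y).
Qed.

Lemma tower_charges_inj t la mu J : 0 < t -> is_partition la -> is_partition mu ->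
  tower_charges t la J = tower_charges t mu J ->
  quotient_tower_row t la J = quotient_tower_row t mu J -> la = mu.
Proof.
move=> t0 pla pmu; elim: J => [_ [] //|J IHJ] /= /eqP.
rewrite eqseq_cat ?size_tower_charges // => /andP[/eqP /IHJ la_mu /eqP cE] qE.
apply: la_mu; apply: charges_quotients_inj cE qE => //; rewrite ?is_partition_tower_row //.
by rewrite !size_tower_row.
Qed.

(** Every positive integer is T * x - r for exactly one x > 0 and one r < T.
    Hence a T-tuple of partitions can be stored as one partition, the parts x
    of the r-th component becoming T * x - r, whose size is at most T times the
    size of the tuple. *)
Definition merge_residues T (X : seq (seq nat)) :=
  sort geq (flatten [seq [seq T * x - r | x <- nth [::] X r] | r <- iota 0 T]).

Lemma geq_total : total geq. Proof. by move=> x y; exact: leq_total. Qed.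
Lemma geq_trans : transitive geq. Proof. by move=> x y z /= yx /leq_trans; apply. Qed.
Lemma geq_anti : antisymmetric geq. Proof. by move=> x y /=; rewrite andbC => /anti_leq. Qed.

Lemma mem_nth_partition X r x : all is_partition X -> x \in nth [::] X r -> 0 < x.
Proof.
move=> pX; have [rX|Xr] := ltnP r (size X); last by rewrite nth_default.
have /andP[_ n0] := allP pX _ (mem_nth [::] rX).
by rewrite lt0n; apply: contraTneq => ->.
Qed.

Lemma is_partition_merge T X : all is_partition X -> is_partition (merge_residues T X).
Proof.
move=> pX; rewrite /is_partition sort_sorted ?mem_sort; last exact: geq_total.
apply/flattenP => -[s /mapP[r]]; rewrite mem_iota /= add0n => rT -> /mapP[x].
move=> /(mem_nth_partition pX) x0; have := leq_pmulr T x0; lia.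
Qed.

Lemma sumn_merge_le T X : size X = T -> sumn (merge_residues T X) <= T * total_size X.
Proof.
move=> sX; rewrite (perm_sumn (permEl (perm_sort _ _))) sumn_flatten -map_comp.
have XE : X = [seq nth [::] X r | r <- iota 0 T] by rewrite -sX [RHS]mkseq_nth.
rewrite /total_size [in leqRHS]XE -map_comp.
elim: (iota 0 T) => [|r s IHs] /=; first by rewrite muln0.
rewrite mulnDr leq_add //; elim: (nth _ _ _) => [|x mu IHmu] /=; lia.
Qed.

(** Uniqueness of quotient and remainder; the positivity of x and z keeps the
    subtractions from being truncated. *)
Lemma residue_inj T x z r s : r < T -> s < T -> 0 < x -> 0 < z ->
  T * x - r = T * z - s -> x = z /\ r = s.
Proof.
move=> rT sT x0 z0 E.
have Tx := leq_pmulr T x0; have Tz := leq_pmulr T z0.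
case: (ltngtP x z) => [xz|zx|xz]; last by subst z; split=> //; lia.
- have : T * x.+1 <= T * z by rewrite leq_mul2l xz orbT.
  rewrite mulnS; lia.
- have : T * z.+1 <= T * x by rewrite leq_mul2l zx orbT.
  rewrite mulnS; lia.
Qed.

Lemma count_merge T X r x : all is_partition X -> r < T -> 0 < x ->
  count_mem (T * x - r) (merge_residues T X) = count_mem x (nth [::] X r).
Proof.
move=> pX rT x0; rewrite count_sort count_flatten -map_comp sumnE big_map.
rewrite (bigD1_seq r) ?iota_uniq ?mem_iota //= big_seq_cond big1 ?addn0.
  rewrite count_map; apply: eq_in_count => z /(mem_nth_partition pX) z0 /=.
  by apply/eqP/eqP => [/residue_inj[]|->].
move=> s; rewrite mem_iota /= add0n => /andP[sT rs].
rewrite count_map; apply/eqP; rewrite -leqn0 leqNgt -has_count.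
apply/hasPn => z /(mem_nth_partition pX) z0 /=.
apply: contra_neq rs => /esym/residue_inj[] //.
Qed.

Lemma merge_residues_inj T X Y : all is_partition X -> all is_partition Y ->
  size X = T -> size Y = T -> merge_residues T X = merge_residues T Y -> X = Y.
Proof.
move=> pX pY sX sY E; apply: (@eq_from_nth _ [::]); first by rewrite sX.
rewrite sX => r rT.
have := allP pX (nth [::] X r) _; rewrite mem_nth ?sX // => /(_ isT)/andP[oX _].
have := allP pY (nth [::] Y r) _; rewrite mem_nth ?sY // => /(_ isT)/andP[oY _].
apply: (sorted_eq geq_trans geq_anti); rewrite ?oX ?oY ?sX ?sY //.
apply/allP => x _ /=; case: x => [|x]; last by rewrite -!(@count_merge T) // E.
have n0 Z : all is_partition Z -> count_mem 0 (nth [::] Z r) = 0.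
  move=> pZ; apply/count_memPn; apply/negP => /(mem_nth_partition pZ); by rewrite ltnn.
by rewrite !n0.
Qed.

(** * Growth of the partition function *)

(** The partitions of n as plain sequences, on which counting is done by lists.
    *)
Definition partition_list n := [seq parts s | s <- enum (partitions n)].

Lemma mem_partition_list n la : (la \in partition_list n) = is_partition la && (sumn la == n).
Proof.
apply/mapP/(partitionsP n la) => [[s]|[s sn <-]]; last by exists s; rewrite ?mem_enum.
by rewrite mem_enum => sn ->; exists s.
Qed.

Lemma partition_list_uniq n : uniq (partition_list n).
Proof. by rewrite map_inj_uniq ?enum_uniq //; exact: parts_inj. Qed.

Lemma size_partition_list n : size (partition_list n) = npartitions n.
Proof. by rewrite size_map -cardE. Qed.

Lemma leq_size_inj (T1 T2 : eqType) (f : T1 -> T2) (s1 : seq T1) (s2 : seq T2) :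
  uniq s1 -> {in s1 &, injective f} -> {in s1, forall x, f x \in s2} -> size s1 <= size s2.
Proof.
move=> us1 fI fs; rewrite -(size_map f); apply: uniq_leq_size.
  by rewrite map_inj_in_uniq.
by move=> y /mapP[x xs ->]; apply: fs.
Qed.

Lemma is_partition_sort_cat s la : 0 \notin s -> is_partition la ->
  is_partition (sort geq (s ++ la)).
Proof.
move=> s0 /andP[_ la0]; rewrite /is_partition sort_sorted; last exact: geq_total.
by rewrite mem_sort mem_cat negb_or s0.
Qed.

Lemma sort_cat_inj s la mu : is_partition la -> is_partition mu ->
  sort geq (s ++ la) = sort geq (s ++ mu) -> la = mu.
Proof.
move=> /andP[ola _] /andP[omu _] E; apply: (sorted_eq geq_trans geq_anti) => //.
by rewrite -(perm_cat2l s) -(perm_sort geq) E perm_sort.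
Qed.

(** Adjoining the parts of a fixed s to a partition is injective, since s can
    be taken away from the multiset of parts. *)
Lemma npartitions_cat m s (P : pred (seq nat)) : 0 \notin s ->
  (forall la, is_partition la -> P (sort geq (s ++ la))) ->
  npartitions m <= count P (partition_list (m + sumn s)).
Proof.
move=> s0 Ps; rewrite -size_partition_list -size_filter.
apply: (@leq_size_inj _ _ (fun la => sort geq (s ++ la))); first exact: partition_list_uniq.
  by move=> la mu; rewrite !mem_partition_list => /andP[? _] /andP[? _]; exact: sort_cat_inj.
move=> la; rewrite mem_filter !mem_partition_list => /andP[pla /eqP <-].
rewrite Ps // is_partition_sort_cat //= (perm_sumn (permEl (perm_sort _ _))).
by rewrite sumn_cat addnC.
Qed.

Lemma npartitions_mono m n : m <= n -> npartitions m <= npartitions n.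
Proof.
move=> mn; have := @npartitions_cat m (nseq (n - m) 1) predT.
rewrite count_predT size_partition_list sumn_nseq mul1n subnKC //; apply=> //.
by rewrite mem_nseq andbF.
Qed.

Lemma npartitions_gt0 n : 0 < npartitions n.
Proof.
apply: leq_trans (npartitions_mono (leq0n n)); rewrite -size_partition_list.
have: [::] \in partition_list 0 by rewrite mem_partition_list.
by case: (partition_list 0).
Qed.

Lemma sumn_uniq_le s1 s2 : uniq s1 -> {subset s1 <= s2} -> sumn s1 <= sumn s2.
Proof.
elim: s1 s2 => //= x s1 IHs s2 /andP[xs1 us1] s12.
have xs2 : x \in s2 by rewrite s12 ?mem_head.
rewrite (perm_sumn (perm_to_rem xs2)) /= leq_add2l IHs // => y ys1.
have := s12 y; rewrite inE ys1 orbT (perm_mem (perm_to_rem xs2)) inE => /(_ isT).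
by case/orP=> // /eqP yx; rewrite -yx ys1 in xs1.
Qed.

(** For 1 <= k <= d, adjoining one part k and d - k parts 1 is an injection
    from the partitions of m to those of m + d having a part k. Weight these
    inequalities by k and add: on the left the weights add up to C(d+1, 2), and
    on the right each partition of m + d counts the sum of its distinct parts,
    at most m + d. *)
Lemma npartitions_step m d :
  d ^ 2 * npartitions m <= 2 * (m + d) * npartitions (m + d).
Proof.
have hk k : 0 < k <= d -> npartitions m <= count (fun nu => k \in nu) (partition_list (m + d)).
  case/andP=> k0 kd; have := @npartitions_cat m (k :: nseq (d - k) 1) (fun nu => k \in nu).
  rewrite /= sumn_nseq mul1n subnKC //; apply.
    by rewrite inE mem_nseq andbF orbF eq_sym -lt0n.
  by move=> la _; rewrite mem_sort mem_head.
have le1 : \sum_(k <- index_iota 1 d.+1) k * npartitions m <=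
           \sum_(nu <- partition_list (m + d)) (m + d).
  apply: (@leq_trans (\sum_(k <- index_iota 1 d.+1)
    \sum_(nu <- partition_list (m + d)) k * (k \in nu))).
    rewrite big_seq [leqRHS]big_seq; apply: leq_sum => k; rewrite mem_index_iota ltnS => /hk kp.
    rewrite -big_distrr /= leq_mul2l; apply/orP; right; apply: leq_trans kp _.
    by rewrite -sum1_count big_mkcond /= leq_sum // => nu _; case: ifP.
  rewrite exchange_big /= big_seq [leqRHS]big_seq; apply: leq_sum => nu.
  rewrite mem_partition_list => /andP[_ /eqP <-].
  have -> : \sum_(k <- index_iota 1 d.+1) k * (k \in nu) =
      sumn [seq k <- index_iota 1 d.+1 | k \in nu].
    by rewrite sumnE big_filter [RHS]big_mkcond; apply: eq_bigr => k _;
      case: ifP; rewrite ?muln1 ?muln0.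
  apply: sumn_uniq_le; first by rewrite filter_uniq ?iota_uniq.
  by move=> k; rewrite mem_filter => /andP[].
move: le1; rewrite -big_distrl /= big_const_seq count_predT iter_addn_0 size_partition_list.
have -> : \sum_(k <- index_iota 1 d.+1) k = 'C(d.+1, 2).
  by rewrite -bin2_sum [RHS]big_ltn // add0n.
have : d ^ 2 <= 2 * 'C(d.+1, 2) by rewrite -mul_bin_diag bin1 mulSn leq_addl.
move=> h1 h2; apply: leq_trans (leq_mul h1 (leqnn _)) _.
by rewrite -!mulnA leq_mul2l h2.
Qed.

(** Iterating the step r times makes p(n) exceed p(m) by a factor of order n^r
    as soon as n - m is a fixed fraction of n; as r is arbitrary, the growth
    beats every polynomial. *)
Lemma npartitions_steps n m d r : m + r * d <= n ->
  d ^ (2 * r) * npartitions m <= (2 * n) ^ r * npartitions n.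
Proof.
elim: r m => [|r IHr] m mn; first by rewrite !expn0 !mul1n npartitions_mono //; lia.
have h1 := IHr (m + d); have {}h1 := h1 _; move: h1; rewrite -addnA -mulSn => /(_ mn) h1.
have h2 := npartitions_step m d.
have h3 : 2 * (m + d) * npartitions (m + d) <= 2 * n * npartitions (m + d).
  by rewrite leq_mul2r; apply/orP; right; move: mn; rewrite mulSn; lia.
have h4 := leq_trans h2 h3.
rewrite mulnS expnD [d ^ 2 * _]mulnC -mulnA (leq_trans (leq_mul (leqnn _) h4)) //.
rewrite mulnCA expnS -[leqRHS]mulnA leq_mul2l h1 orbT //.
Qed.

(** * Partitions with a light row in their quotient tower *)

Lemma size_bounded_seqs (L B : nat) :
  exists2 D : seq (seq nat), size D = B.+1 ^ L &
    forall s, size s = L -> all (fun c => c <= B) s -> s \in D.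
Proof.
exists [seq map val (val tu) | tu <- enum {: L.-tuple 'I_B.+1}].
  by rewrite size_map -cardE card_tuple card_ord.
move=> s sL sB; have sz : size [seq inord c : 'I_B.+1 | c <- s] == L by rewrite size_map sL.
apply/mapP; exists (Tuple sz); first by rewrite mem_enum.
rewrite /= -map_comp -[LHS]map_id; apply/eq_in_map => c cs /=.
by rewrite inordK // ltnS (allP sB).
Qed.

(** The rows 0, ..., J - 1 of the core tower have total size at most |la| - t^J
    * (size of row J), so they can be large only when t^J * (size of row J)
    falls short of |la|. *)
Definition light_tower t J M la := t ^ J * total_size (quotient_tower_row t la J) <= M.

(** A partition is determined by its tower charges, which take polynomially
    many values, and by row J, which merges into a partition of size at most
    t^J times that of the row. *)
Lemma count_light_tower t J M n : 0 < t ->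
  count (light_tower t J M) (partition_list n) <=
    (t * n).+1 ^ (\sum_(j < J) t ^ j.+1) * (M.+1 * npartitions M).
Proof.
move=> t0; set L := \sum_(j < J) _; have [D sD inD] := size_bounded_seqs L (t * n).
pose P := flatten [seq partition_list m | m <- iota 0 M.+1].
have sP : size P <= M.+1 * npartitions M.
  rewrite size_flatten /shape -map_comp sumnE big_map.
  apply: (@leq_trans (\sum_(m <- iota 0 M.+1) npartitions M)).
    rewrite big_seq [leqRHS]big_seq; apply: leq_sum => m; rewrite mem_iota => mM.
    by rewrite /= size_partition_list npartitions_mono //; lia.
  by rewrite big_const_seq count_predT iter_addn_0 size_iota mulnC.
rewrite -sD (leq_trans _ (leq_mul (leqnn _) sP)) // -size_filter.
pose f la := (tower_charges t la J, merge_residues (t ^ J) (quotient_tower_row t la J)).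
rewrite -(size_allpairs (fun a b => (a, b)) D P).
apply: (@leq_size_inj _ _ f); first by rewrite filter_uniq ?partition_list_uniq.
  move=> la mu; rewrite !mem_filter !mem_partition_list.
  move=> /andP[_ /andP[pla _]] /andP[_ /andP[pmu _]].
  case=> cE /merge_residues_inj qE; apply: (tower_charges_inj t0 pla pmu cE).
  by apply: qE; rewrite ?is_partition_tower_row ?size_tower_row.
move=> la; rewrite mem_filter mem_partition_list => /and3P[lM pla /eqP sla].
apply: allpairs_f.
  by apply: inD; [exact: size_tower_charges | rewrite -sla tower_charges_le].
apply/flattenP; exists (partition_list (sumn (merge_residues (t ^ J) (quotient_tower_row t la J)))).
  apply: map_f; rewrite mem_iota /= add0n ltnS (leq_trans _ lM) //.
  by rewrite sumn_merge_le ?size_tower_row.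
by rewrite mem_partition_list is_partition_merge ?is_partition_tower_row /=.
Qed.

(** The left-hand side has degree k = 2 L + 3 in n, one less than the exponent
    of d on the right, while d is at least n / q; once d exceeds the constants,
    the extra factor d absorbs them. *)
Lemma polynomial_leq_exp t E L q n M d (k := L + 1 + L.+2) : 0 < n -> M <= n -> n <= q * d ->
  E * (t.+1 ^ L * (2 * 2 ^ L.+2)) * q ^ k <= d ->
  E * ((t * n).+1 ^ L * M.+1) * (2 * n) ^ L.+2 <= d ^ (2 * L.+2).
Proof.
move=> n0 Mn nd Cd; set r := L.+2 in Cd *.
apply: (@leq_trans (E * ((t.+1 * n) ^ L * (2 * n)) * (2 * n) ^ r)).
  rewrite leq_mul2r; apply/orP; right; rewrite leq_mul2l; apply/orP; right.
  apply: leq_mul; last by lia.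
  case: (L) => // L'; rewrite leq_exp2r ?mulSn //; lia.
have -> : E * ((t.+1 * n) ^ L * (2 * n)) * (2 * n) ^ r =
    E * (t.+1 ^ L * (2 * 2 ^ r)) * n ^ k.
  by rewrite /k !expnD expn1 !expnMn; ring.
have -> : 2 * r = k.+1 by rewrite /k /r; lia.
rewrite expnS; apply: leq_trans (leq_mul Cd (leqnn _)).
by rewrite -[leqRHS]mulnA -expnMn leq_mul2l leq_exp2r ?nd ?orbT // /k; lia.
Qed.

(** The light towers are at most a polynomial in n times p(n - n/E), and p(n)
    exceeds p(n - n/E) by any power of n. The number of steps r = L + 2 is
    chosen to beat the degree L + 1 of that polynomial. *)
Lemma light_tower_rare t J E : 0 < t -> 0 < E -> exists n0, forall n, n0 <= n ->
  E * count (light_tower t J (n - n %/ E)) (partition_list n) <= npartitions n.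
Proof.
move=> t0 E0; set L := \sum_(j < J) t ^ j.+1.
pose r := L.+2; pose q := E * r.
pose C := E * (t.+1 ^ L * (2 * 2 ^ r)) * (2 * q) ^ (L + 1 + r).
have q0 : 0 < q by rewrite muln_gt0 E0.
exists (q * C.+1) => n n_large; set M := n - n %/ E; set d := n %/ q.
have dC : C < d by rewrite leq_divRL // mulnC.
have d_gt0 : 0 < d by apply: leq_ltn_trans dC.
have n0 : 0 < n by apply: leq_trans n_large; rewrite muln_gt0 q0.
have Mn : M <= n by exact: leq_subr.
have nd : n <= 2 * q * d.
  rewrite ltnW // (leq_trans (ltn_ceil n q0)) // -/d [2 * q]mulnC -mulnA mulnC.
  by rewrite leq_mul2l mul2n -addnn -addn1 leq_add2l d_gt0 orbT.
have steps : M + r * d <= n.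
  rewrite -[leqRHS](subnK (leq_div n E)) leq_add2l.
  by rewrite mulnC /d /q divnMA leq_divM.
have h1 := npartitions_steps steps.
have h2 := @count_light_tower t J M n t0; rewrite -/L in h2.
have polyb := @polynomial_leq_exp t E L _ n M d n0 Mn nd (ltnW dC); rewrite -/r in polyb.
have d0 : 0 < d ^ (2 * r) by rewrite expn_gt0 d_gt0.
rewrite -(leq_pmul2l d0).
apply: (@leq_trans (d ^ (2 * r) * (E * ((t * n).+1 ^ L * (M.+1 * npartitions M))))).
  by rewrite leq_pmul2l // leq_pmul2l.
apply: (@leq_trans (E * ((t * n).+1 ^ L * M.+1) * (d ^ (2 * r) * npartitions M))).
  by apply/eq_leq; ring.
apply: (leq_trans (leq_mul (leqnn _) h1)).
by rewrite mulnA leq_mul2r polyb orbT.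
Qed.

(** * Averages *)

Import Order.TTheory GRing.Theory Num.Theory.
Local Open Scope classical_set_scope.
Local Open Scope ring_scope.

Section Averages.
Variables (R : realType) (t : nat).

(** Total size of the core tower of la, the quantity subtracted from |la| in
    the defect. *)
Definition core_total (la : seq nat) : R :=
  limn (series (fun j => (total_size (core_tower_row t la j))%:R : R)).

Lemma core_total_bounds la J : (0 < t)%N -> is_partition la ->
  0 <= core_total la <= (sumn la)%:R
    + (total_size (quotient_tower_row t la J))%:R
    - (t ^ J * total_size (quotient_tower_row t la J))%:R.
Proof.
move=> t_gt0 pla; rewrite /core_total; set u := fun j : nat => _.
have u_ge0 j : 0 <= u j by exact: ler0n.
have nd : nondecreasing_seq (series u).
  by apply: (@nondecreasing_series _ u xpredT 0%N) => n _ _.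
have ub K : series u K <= (sumn la)%:R
    + (total_size (quotient_tower_row t la J))%:R
    - (t ^ J * total_size (quotient_tower_row t la J))%:R.
  apply: (@le_trans _ _ (series u (J + K)%N)); first by apply: nd; rewrite leq_addl.
  rewrite lerBrDr seriesEnat /= -natr_sum -!natrD ler_nat.
  by have := core_tower_sum_le t_gt0 pla J K; lia.
have cu : cvgn (series u).
  by apply: nondecreasing_is_cvgn => //; eexists => _ [K _ <-]; exact: ub.
apply/andP; split; last by apply: limr_le => //; near=> K; exact: ub.
by apply: limr_ge => //; near=> K; apply: sumr_ge0.
Unshelve. all: by end_near.
Qed.

(** Heavy towers have |la| - t^J w_J < |la| / E and w_J <= |la| / t^J; for
    light ones the trivial bound |la| is enough. *)
Lemma core_total_le n la J E : (0 < t)%N -> (0 < E)%N -> is_partition la -> sumn la = n ->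
  core_total la <= n%:R * ((t ^ J)%:R^-1 + E%:R^-1 + (light_tower t J (n - n %/ E) la)%:R).
Proof.
move=> t_gt0 E0 pla sla; have tJ : (0 < t ^ J)%N by rewrite expn_gt0 t_gt0.
set w := total_size (quotient_tower_row t la J).
rewrite !mulrDr; case: (boolP (light_tower _ _ _ _)) => [_|].
  (* Row 0 gives the trivial bound |la|. *)
  have /andP[_ /le_trans->] // := core_total_bounds 0 t_gt0 pla.
  rewrite /total_size /= addn0 mul1n addrK sla mulr1 lerDr.
  by rewrite addr_ge0 // mulr_ge0 ?invr_ge0.
rewrite /light_tower -/w -ltnNge => heavy; rewrite mulr0 addr0.
have /andP[_ /le_trans->] // := core_total_bounds J t_gt0 pla.
rewrite -/w sla [X in _ <= X]addrC addrAC lerD //.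
  rewrite ler_pdivlMr ?ltr0n //.
  have : (E * n <= n + t ^ J * w * E)%N.
    have := leq_divM n E; nia.
  by rewrite mulrBl -!natrM lerBlDr -natrD ler_nat mulnC.
rewrite ler_pdivlMr ?ltr0n // -natrM ler_nat mulnC -sla.
exact: tower_row_le.
Qed.

Lemma sum_partition_list n (F : seq nat -> R) :
  \sum_(s in partitions n) F (parts s) = \sum_(la <- partition_list n) F la.
Proof. by rewrite big_map big_enum. Qed.

Lemma sum_core_total_le n J E : (0 < t)%N -> (0 < E)%N ->
  \sum_(la <- partition_list n) core_total la <=
    n%:R * ((npartitions n)%:R * ((t ^ J)%:R^-1 + E%:R^-1)
            + (count (light_tower t J (n - n %/ E)) (partition_list n))%:R).
Proof.
move=> t_gt0 E0; set b := light_tower t J (n - n %/ E).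
have -> : (count b (partition_list n))%:R = \sum_(la <- partition_list n) (b la)%:R :> R.
  by rewrite -sum1_count big_mkcond natr_sum; apply: eq_bigr => la _; case: (b la).
rewrite -size_partition_list.
have -> : (size (partition_list n))%:R * ((t ^ J)%:R^-1 + E%:R^-1) =
    \sum_(la <- partition_list n) ((t ^ J)%:R^-1 + E%:R^-1) :> R.
  by rewrite big_const_seq count_predT iter_addr_0 mulr_natl.
rewrite -big_split /= mulr_sumr big_seq [leRHS]big_seq.
apply: ler_sum => la; rewrite mem_partition_list => /andP[pla /eqP sla].
apply: le_trans (core_total_le J t_gt0 E0 pla sla) _.
by [].
Qed.

Lemma average_defectE n : (1 < t)%N -> n%:R / (t%:R - 1) - average_defect R t n =
  ((npartitions n)%:R^-1 * \sum_(la <- partition_list n) core_total la) / (t%:R - 1).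
Proof.
move=> t1; have p0 : (npartitions n)%:R != 0 :> R by rewrite pnatr_eq0 -lt0n npartitions_gt0.
rewrite /average_defect sum_partition_list.
have -> : \sum_(la <- partition_list n) defect R t la =
  ((npartitions n)%:R * n%:R - \sum_(la <- partition_list n) core_total la) / (t%:R - 1).
  rewrite -size_partition_list mulr_natl -iter_addr_0 -(count_predT (partition_list n)) -big_const_seq.
  rewrite -sumrB mulr_suml big_seq [RHS]big_seq.
  by apply: eq_bigr => la; rewrite mem_partition_list => /andP[_ /eqP <-].
rewrite mulrA -mulrBl; congr (_ / _).
by rewrite mulrBr mulKf // opprB addrC subrK.
Qed.

(** With 3 / E <= eps and J = E, the two main terms are each at most n / E, and
    the light towers, being at most a fraction 1 / E of all, contribute at most
    n / E more. *)
Lemma average_core_total_small (eps : R) : (1 < t)%N -> 0 < eps ->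
  exists n0, forall n, (n0 <= n)%N ->
  0 <= (npartitions n)%:R^-1 * \sum_(la <- partition_list n) core_total la <= eps * n%:R.
Proof.
move=> t1 eps0; have t_gt0 := ltnW t1; have eps3 : 0 < 3 / eps by rewrite divr_gt0.
set E := Num.bound (3 / eps); have Eeps := archi_boundP (ltW eps3).
have ER : 0 < E%:R :> R by exact: lt_trans Eeps.
have E0 : (0 < E)%N by rewrite -(ltr0n R).
have [n0 rare] := light_tower_rare E t_gt0 E0; exists n0 => n /rare {}rare.
have p0 : 0 < (npartitions n)%:R :> R by rewrite ltr0n npartitions_gt0.
apply/andP; split.
  rewrite mulr_ge0 ?invr_ge0 ?ler0n // big_seq sumr_ge0 // => la.
  by rewrite mem_partition_list => /andP[pla _]; have /andP[] := core_total_bounds 0 t_gt0 pla.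
rewrite mulrC ler_pdivrMr // (le_trans (sum_core_total_le n E t_gt0 E0)) //.
rewrite [eps * _]mulrC -mulrA ler_wpM2l ?ler0n //.
have tE : (t ^ E)%:R^-1 <= E%:R^-1 :> R.
  by rewrite lef_pV2 ?posrE ?ltr0n ?expn_gt0 ?t_gt0 // ler_nat ltnW // ltn_expl.
have {}rare : (count (light_tower t E (n - n %/ E)) (partition_list n))%:R
    <= (npartitions n)%:R * E%:R^-1 :> R.
  by rewrite ler_pdivlMr // -natrM ler_nat mulnC.
have E3 : 3 * E%:R^-1 <= eps.
  by rewrite ler_pdivrMr // mulrC -ler_pdivrMr // ltW.
apply: le_trans (_ : (npartitions n)%:R * (3 * E%:R^-1) <= _); last first.
  by rewrite [leRHS]mulrC ler_wpM2l // ler0n.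
apply: le_trans (lerD (ler_wpM2l (ltW p0) (lerD tE (lexx _))) rare) _.
by rewrite -mulrDr; apply: ler_wpM2l; [exact: ltW | lra].
Qed.

End Averages.

Theorem corollary1p3 (R : realType) (t : nat) (ht : (2 <= t)%N) :
  (fun n : nat => average_defect R t n) ~_\oo
  (fun n : nat => n%:R / (t%:R - 1) : R).
Proof.
apply/eqaddoP => eps eps0.
have [n0 small] := average_core_total_small ht eps0.
exists n0 => // n /= n0n; have /andP[S0 Sn] := small n n0n.
have t1 : 0 < t%:R - 1 :> R by rewrite subr_gt0 ltr1n.
rewrite !fctE distrC average_defectE // normrM [in leRHS]normrM (ger0_norm S0).
by rewrite normr_nat mulrA ler_pM2r // normr_gt0 invr_neq0 // gt_eqF.
Qed.
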